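(* Assume the standing assumptions (A1)–(A4) listed in the context, that $\sup_{x\ge0}r_0(x)<+\infty$, and that $\int_0^{+\infty}y^2\,\nu(dy)<+\infty$. If, on the interval $[0,T^\ast]$, there exists a non-exploding solution, taking values in $L^{2,\gamma}_+$, of the equation $$r(t,x)=\tilde a(t,x)\,\exp\Big(\int_0^t J'\Big(\int_0^{t-s+x}\tilde\lambda(s,v)r(s,v)\,dv\Big)\tilde\lambda(s,t-s+x)\,ds\Big),\qquad t\in[0,T^\ast],\ x\ge0,$$ then it is unique; that is, if $r_1,r_2$ are two solutions with $P(r_i\in\mathbb L^{2,\gamma}_+)=1$, $i=1,2$, then almost surely $r_1(t,x)=r_2(t,x)$ for all $(t,x)\in[0,T^\ast]\times[0,+\infty)$.
   Context: Fix $T^\ast\in(0,+\infty)$, $\gamma>0$ and a filtered probability space $(\Omega,(\mathcal F_t)_{t\ge0},P)$ carrying a real-valued Lévy process $L$ with Lévy exponent $J$: $\mathbf E(e^{-zL(t)})=e^{tJ(z)}$, $$J(z)=-az+\tfrac12 qz^2+\int_{\mathbb R}\big(e^{-zy}-1+zy\mathbf 1_{(-1,1)}(y)\big)\,\nu(dy),$$ where $a\in\mathbb R$, $q\ge0$ and the Lévy measure $\nu$ satisfies $\int_{\mathbb R}(y^2\wedge1)\,\nu(dy)<\infty$. Write $\triangle L(s)=L(s)-L(s-)$. Let $\tilde\lambda:\mathbb R_+\times\mathbb R_+\to\mathbb R$ be a deterministic function with $\tilde\lambda(\cdot,x)$ continuous for each $x\ge0$ and $\underline\lambda:=\inf_{t\in[0,T^\ast],x\ge0}\tilde\lambda(t,x)>0$,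 $\bar\lambda:=\sup_{t\in[0,T^\ast],x\ge0}\tilde\lambda(t,x)<+\infty$. Let $r_0:\mathbb R_+\to\mathbb R$ be a deterministic initial curve. Standing assumptions: (A1) $r_0$ is positive. (A2) The support of $\nu$ is contained in $(-1/\bar\lambda,+\infty)$. (A3) The random field $|\int_0^t\tilde\lambda(s,t-s+x)\,dL(s)|$ is bounded in $(t,x)\in[0,T^\ast]\times[0,+\infty)$ (almost surely). (A4) $\int_{(-1/\bar\lambda,1)}y^2\,\nu(dy)+\int_1^\infty y\,\nu(dy)<\infty$. (Under these, $J'$ is finite on $[0,+\infty)$.) Define $\tilde a(t,x)=r_0(t+x)\,\tilde b(t,x)$ with $$\tilde b(t,x)=e^{\int_0^t\tilde\lambda(s,t-s+x)dL(s)-\frac q2\int_0^t\tilde\lambda^2(s,t-s+x)ds}\prod_{0\le s\le t}\big(1+\tilde\lambda(s,t-s+x)\triangle L(s)\big)e^{-\tilde\lambda(s,t-s+x)\triangle L(s)}.$$ Spaces: $L^{2,\gamma}_+$ is the set of $h:\mathbb R_+\to\mathbb R_+$ with $\|h\|^2_{L^{2,\gamma}_+}=\int_0^\infty|h(x)|^2e^{\gamma x}dx<\infty$; $\mathbb L^{2,\gamma}_+$ is the set of $h:[0,T^\ast]\times[0,+\infty)\to\mathbb R_+$ with $\sup_{t\in[0,T^\ast]}\|h(t,\cdot)\|^2_{L^{2,\gamma}_+}<\infty$. A solution $r$ is a random field satisfying the equation such that $r(\cdot,x)$ is adapted and càdlàg on $[0,T^\ast]$ for each $x\ge0$; it is non-exploding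 in $L^{2,\gamma}_+$ on $[0,T^\ast]$ if $P(r\in\mathbb L^{2,\gamma}_+)=1$. *)

(* Defs.v *)
From HB Require Import structures.
From mathcomp Require Import all_boot all_order all_algebra.
From mathcomp Require Import all_classical all_reals all_analysis.

Set Implicit Arguments.
Unset Strict Implicit.
Unset Printing Implicit Defensive.

Import Order.TTheory GRing.Theory Num.Theory.
Import numFieldNormedType.Exports.

Local Open Scope classical_set_scope.
Local Open Scope ring_scope.

(* Functions on R_+ (resp. R_+ x R_+) are total functions on R (resp. R x R);
   only their values at nonnegative arguments are ever constrained or used. *)

Section stochastic_basis.
Context {R : realType} {d : measure_display} {Omega : measurableType d}.
Implicit Types (P : probability Omega R) (F : R -> set (set Omega)).

Record filtration F : Prop := Filtration {
  filtration_sigma : forall t : R, 0 <= t -> sigma_algebra setT (F t) ;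
  filtration_sub : forall t : R, 0 <= t -> F t `<=` d.-measurable ;
  filtration_mono : forall s t : R, 0 <= s -> s <= t -> F s `<=` F t }.

(* Measurability with respect to a sub-sigma-algebra G. *)
Definition measurable_wrt (G : set (set Omega)) (X : Omega -> R) :=
  preimage_set_system setT X measurable `<=` G.

Definition independent_of P (G : set (set Omega)) (X : Omega -> R) :=
  forall A (B : set R), G A -> measurable B ->
    (P (A `&` X @^-1` B) = P A * P (X @^-1` B))%E.

Definition cvg_in_probability P (X : (Omega -> R)^nat) (Y : Omega -> R) :=
  forall eps : R, 0 < eps ->
    P [set w | eps <= `|X n w - Y w|] @[n --> \oo] --> 0%E.

(* Right-continuity and left limits relative to D.  At the left end point of D
   the filter of left neighbourhoods is improper and nothing is required. *)
Definition cadlag (D : set R) (f : R -> R) :=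
  forall t, D t ->
    f u @[u --> within (D `&` [set u | t < u]) (nbhs t)] --> f t /\
    cvg (f u @[u --> within (D `&` [set u | u < t]) (nbhs t)]).

Record levy_process P F (L : R -> Omega -> R) : Prop := LevyProcess {
  levy_adapted : forall t : R, 0 <= t -> measurable_wrt (F t) (L t) ;
  levy_start : {ae P, forall w, L 0 w = 0} ;
  levy_indep : forall s t : R, 0 <= s -> s <= t ->
    independent_of P (F s) (L t \- L s) ;
  levy_stationary : forall (s t : R) (B : set R), 0 <= s -> s <= t -> measurable B ->
    P ((L t \- L s) @^-1` B) = P (L (t - s) @^-1` B) ;
  levy_cadlag : {ae P, forall w, cadlag `[0, +oo[ (L ^~ w)} }.

(* The jump at time s of a cadlag path on [0, +oo[, with the convention
   f (0-) = f 0. *)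
Definition jump (f : R -> R) (s : R) : R :=
  if 0 < s then f s - lim (f u @[u --> s^'-]) else 0.

End stochastic_basis.

Section levy_triplet.
Context {R : realType}.
Implicit Types (nu : {measure set (measurableTypeR R) -> \bar R}).

Definition levy_measure nu :=
  nu [set 0] = 0%E /\
  (\int[nu]_y (Num.min (y ^+ 2) 1)%:E < +oo)%E.

Definition measure_support nu : set R :=
  [set y | forall U : set R, open_nbhs y U -> (0 < nu U)%E].

(* The value is +oo exactly when exp (- z y) is not nu-integrable at infinity. *)
Definition levy_exponent (a q : R) nu (z : R) : \bar R :=
  ((- a * z + q / 2 * z ^+ 2)%:E +
   \int[nu]_y (expR (- z * y) - 1 + z * y * \1_(`]-1, 1[ : set R) y)%:E)%E.

(* Derivative of J as a function on [0, +oo[: two-sided at z > 0, right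
   derivative at z = 0 (J may be infinite on ]-oo, 0[). *)
Definition levy_exponent' (a q : R) nu (z : R) : R :=
  let J y := fine (levy_exponent a q nu y) in
  lim ((J y - J z) / (y - z)
         @[y --> within [set y | 0 <= y /\ y != z] (nbhs z)]).

(* E (exp (- z L t)) = exp (t J z) for every real z, both sides being +oo
   simultaneously (with 0 * +oo = 0 at t = 0). *)
Definition has_levy_exponent {d : measure_display} {Omega : measurableType d}
    (P : probability Omega R) (L : R -> Omega -> R) (a q : R) nu :=
  forall t z : R, 0 <= t ->
    ('E_P[fun w => expR (- z * L t w)]
     = expeR (t%:E * levy_exponent a q nu z))%E.

End levy_triplet.

Section deterministic_stochastic_integral.
Context {R : realType} {d : measure_display} {Omega : measurableType d}.

(* ((u, v), c) stands for the step function c * 1_{]u, v]}. *)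
Definition step_fun (s : seq (R * R * R)) (x : R) : R :=
  \sum_(p <- s) p.2 * \1_(`]p.1.1, p.1.2] : set R) x.

Definition step_integral (L : R -> Omega -> R) (s : seq (R * R * R))
    (w : Omega) : R :=
  \sum_(p <- s) p.2 * (L p.1.2 w - L p.1.1 w).

(* X is a version of \int_0^t f(s) dL(s), for a bounded deterministic f: the
   limit in probability of the elementary integrals of uniformly bounded step
   functions converging to f almost everywhere on [0, t].  Such step functions
   exist for every bounded measurable f, and for a Levy process L the limit
   exists and, up to a null set, does not depend on their choice. *)
Definition is_levy_integral (P : probability Omega R) (L : R -> Omega -> R)
    (f : R -> R) (t : R) (X : Omega -> R) :=
  measurable_fun setT X /\
  exists s : (seq (R * R * R))^nat,
    [/\ forall n p, p \in s n -> [/\ 0 <= p.1.1, p.1.1 <= p.1.2 & p.1.2 <= t],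
        exists M : R, forall n (x : R), `|step_fun (s n) x| <= M,
        {ae @lebesgue_measure R, forall x : R, `[0, t]%classic x ->
          step_fun (s n) x @[n --> \oo] --> f x} &
        cvg_in_probability P (fun n => step_integral L (s n)) X].

End deterministic_stochastic_integral.

Section products.
Context {R : realType}.

(* The filter of tails of the directed set of finite subsets of D. *)
Definition finite_subsets (D : set R) : set_system (set R) :=
  [set Q | exists A, [/\ finite_set A, A `<=` D &
     forall B, finite_set B -> A `<=` B -> B `<=` D -> Q B]].

(* \prod_{s in D} u s for possibly uncountable D, as the limit of the net of
   finite subproducts. *)
Definition unordered_prod (D : set R) (u : R -> R) : R :=
  lim ((\big[*%R/1]_(s \in B) u s) @[B --> finite_subsets D]).

End products.

Section equation.
Context {R : realType} {d : measure_display} {Omega : measurableType d}.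
Local Notation mu := (@lebesgue_measure R).

Definition vol_range (Tstar : R) (lam : R -> R -> R) : set R :=
  [set y | exists t x : R, [/\ 0 <= t <= Tstar, 0 <= x & y = lam t x]].

(* 0 < vol_inf forces a lower bound, as inf is 0 on sets without one; vol_sup is
   meaningful only together with has_ubound (vol_range Tstar lam). *)
Definition vol_inf Tstar lam : R := inf (vol_range Tstar lam).
Definition vol_sup Tstar lam : R := sup (vol_range Tstar lam).

(* In b_tilde and a_tilde, I is the random field
   I t x = \int_0^t lam(s, t - s + x) dL(s). *)
Definition b_tilde (q : R) (lam : R -> R -> R) (L : R -> Omega -> R)
    (I : R -> R -> Omega -> R) (t x : R) (w : Omega) : R :=
  expR (I t x w - q / 2 * \int[mu]_(s in `[0, t]) (lam s (t - s + x)) ^+ 2) *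
  unordered_prod `[0, t] (fun s =>
    (1 + lam s (t - s + x) * jump (L ^~ w) s) *
    expR (- (lam s (t - s + x) * jump (L ^~ w) s))).

Definition a_tilde (q : R) (r0 : R -> R) (lam : R -> R -> R)
    (L : R -> Omega -> R) (I : R -> R -> Omega -> R)
    (t x : R) (w : Omega) : R :=
  r0 (t + x) * b_tilde q lam L I t x w.

(* Square of the norm of L^{2,gamma}_+. *)
Definition normsq_gamma (gamma : R) (h : R -> R) : \bar R :=
  \int[mu]_(x in `[0, +oo[) (`|h x| ^+ 2 * expR (gamma * x))%:E.

Definition L2gamma (gamma : R) (h : R -> R) :=
  [/\ measurable_fun (`[0, +oo[ : set R) h,
      forall x : R, 0 <= x -> 0 <= h x &
      (normsq_gamma gamma h < +oo)%E].

Definition LL2gamma (Tstar gamma : R) (h : R -> R -> R) :=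
  (forall t : R, 0 <= t <= Tstar -> L2gamma gamma (h t)) /\
  (ereal_sup [set normsq_gamma gamma (h t) | t in `[0%R, Tstar]] < +oo)%E.

(* The equation at (t, x) for a path r.  Integrals are total functions, so that
   both Lebesgue integrals exist is part of its meaning. *)
Definition satisfies_equation (J' : R -> R) (lam atil r : R -> R -> R)
    (t x : R) :=
  let z s := \int[mu]_(v in `[0, t - s + x]) (lam s v * r s v) in
  [/\ forall s : R, 0 <= s <= t ->
        mu.-integrable `[0, t - s + x] (fun v => (lam s v * r s v)%:E),
      mu.-integrable `[0, t] (fun s => (J' (z s) * lam s (t - s + x))%:E) &
      r t x = atil t x *
        expR (\int[mu]_(s in `[0, t]) (J' (z s) * lam s (t - s + x)))].

Record is_solution (P : probability Omega R) (F : R -> set (set Omega))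
    (Tstar : R) (J' : R -> R) (lam : R -> R -> R)
    (atil r : R -> R -> Omega -> R) : Prop := IsSolution {
  sol_adapted : forall t x : R, 0 <= t <= Tstar -> 0 <= x ->
    measurable_wrt (F t) (r t x) ;
  sol_cadlag : forall x : R, 0 <= x ->
    {ae P, forall w, cadlag `[0, Tstar] (fun t => r t x w)} ;
  sol_equation : {ae P, forall w, forall t x : R, 0 <= t <= Tstar -> 0 <= x ->
    satisfies_equation J' lam (fun t x => atil t x w) (fun t x => r t x w)
      t x} }.

Definition non_exploding (P : probability Omega R) (Tstar gamma : R)
    (r : R -> R -> Omega -> R) :=
  {ae P, forall w, LL2gamma Tstar gamma (fun t x => r t x w)}.

End equation.

(* Main.v *)
Require Import Defs.
From HB Require Import structures.
From mathcomp Require Import all_boot all_order all_algebra.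
From mathcomp Require Import all_classical all_reals all_analysis.
From mathcomp Require Import measurable_realfun ring lra.

Set Implicit Arguments.
Unset Strict Implicit.
Unset Printing Implicit Defensive.

Import Order.TTheory GRing.Theory Num.Theory.
Import numFieldNormedType.Exports.

Local Open Scope classical_set_scope.
Local Open Scope ring_scope.

(** Uniqueness is a pathwise statement: once the path of the Levy process is
    fixed, the random factor a_tilde is the same for both solutions, and
    what remains is a Gronwall argument in L^1.

    Write E_i(t,x) for the exponent in the equation solved by r_i.  Since
    r_i = a_tilde exp(E_i) is nonnegative, the mean value theorem for exp gives
    |r_1 - r_2| <= (r_1 + r_2) |E_1 - E_2|.  Let D(t) be the L^1 distance of
    r_1(t,.) and r_2(t,.) on the half-line.  The weight exp(gamma x) makes the
    L^{2,gamma} bound an L^1 bound ([L2gamma_mass]), so the inner integrals of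
    lam * r_i stay in a fixed compact interval [0, Z], on which J' is Lipschitz
    ([levy_exponent'_lipschitz]).  Hence |E_1 - E_2|(t,x) is at most a constant
    times the integral of D over [0, t], uniformly in x ([drift_dist]), and
    integrating in x bounds D(t) by a constant times the same integral
    ([L1dist_le]).

    The function D may fail to be measurable, because the exceptional null set of
    the cadlag property depends on x.  Gronwall is therefore run on majorants: if
    D(s) <= M exp(b s) on [0, T], then D(t) <= (M / 2) exp(b t) as soon as b is
    large, so the best constant M vanishes ([L1dist_le0]).  Then E_1 = E_2
    at every point, and r_1 = r_2 everywhere rather than almost everywhere.

    The Lipschitz bound comes from differentiating J under the integral sign.
    Jumps at or below -1/sup lam carry no mass, and on the remaining jump
    sizes y the integrand of J, its derivative in z and the second order
    Taylor remainder are all dominated, for z in [0, Z], by a multiple of y^2,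
    which is integrable. *)

(** * Exponentials, dominated integrals and slopes *)

(** Mean value theorem for exp: its slope on ]-oo, B] is at most exp B. *)
Lemma expR_lipschitz (R : realType) (B a b : R) : a <= B -> b <= B ->
  `|expR a - expR b| <= expR B * `|a - b|.
Proof.
wlog ba : a b / b <= a => [hw aB bB|aB _].
  have [ba|/ltW ab] := leP b a; first exact: hw.
  by rewrite distrC [`|a - b|]distrC; exact: hw.
rewrite !ger0_norm ?subr_ge0 ?ler_expR//.
have -> : expR b = expR a * expR (b - a) by rewrite -expRD addrC subrK.
have := expR_ge1Dx (b - a); have := expR_gt0 a.
have : expR a <= expR B by rewrite ler_expR.
move: ba; rewrite -subr_le0; move: (expR (b - a)) (expR a) (expR B) => u v w.
nra.
Qed.

(** The remainder is nonnegative by convexity, and convexity at the other end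
    point bounds it by (a - b) (exp a - exp b). *)
Lemma expR_taylor1 (R : realType) (B a b : R) : a <= B -> b <= B ->
  `|expR a - expR b - (a - b) * expR b| <= expR B * (a - b) ^+ 2.
Proof.
move=> aB bB.
have bnd u v : expR u - expR v <= (u - v) * expR u :> R.
  have -> : expR v = expR u * expR (v - u) by rewrite -expRD addrC subrK.
  have := expR_ge1Dx (v - u); have := expR_gt0 u.
  by move: (expR (v - u)) (expR u) => x y; nra.
rewrite ger0_norm; last by have := bnd b a; lra.
apply: (@le_trans _ _ ((a - b) * (expR a - expR b))).
  by have := bnd a b; lra.
rewrite (le_trans (ler_norm _))// normrM -[(a - b) ^+ 2]real_normK ?num_real//.
rewrite [_ ^+ 2]expr2 mulrCA.
by rewrite ler_wpM2l// expR_lipschitz.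
Qed.

Lemma measurable_integrand d (T : measurableType d) (R : realType)
    (mu : {measure set T -> \bar R}) (D : set T) (f : T -> R) :
  mu.-integrable D (EFin \o f) -> measurable_fun D f.
Proof. by case/integrableP => /measurable_EFinP. Qed.

Lemma integrable_scale d (T : measurableType d) (R : realType)
    (mu : {measure set T -> \bar R}) (D : set T) (f : T -> R) (k : R) :
  measurable D -> mu.-integrable D (EFin \o f) ->
  mu.-integrable D (EFin \o (fun x => k * f x)).
Proof. by move=> mD; exact: integrableZl. Qed.

Lemma Rintegral_dominated d (T : measurableType d) (R : realType)
    (mu : {measure set T -> \bar R}) (D : set T) (f g : T -> R) (C : R) :
  measurable D -> measurable_fun D f -> mu.-integrable D (EFin \o g) ->
  (forall x, D x -> `|f x| <= C * g x) ->
  mu.-integrable D (EFin \o f) /\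
  `|\int[mu]_(x in D) f x| <= C * \int[mu]_(x in D) g x.
Proof.
move=> mD mf ig fg.
have iCg : mu.-integrable D (EFin \o (fun x => C * g x)).
  exact: integrable_scale.
have intf : mu.-integrable D (EFin \o f).
  apply: le_integrable iCg => //; first exact/measurable_EFinP.
  by move=> x Dx /=; rewrite lee_fin (le_trans (fg _ Dx))// ler_norm.
split=> //; rewrite -RintegralZl//.
apply: le_trans (le_normr_Rintegral mD intf) _.
by apply: le_Rintegral => //; exact: integrable_norm.
Qed.

(** A second order remainder bound identifies the limit of the difference
    quotients, one-sided when z = 0. *)
Lemma lim_slope (R : realType) (f : R -> R) (z l K : R) : 0 <= z ->
  (forall w, 0 <= w -> w <= z + 1 ->
    `|f w - f z - (w - z) * l| <= K * (w - z) ^+ 2) ->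
  lim ((f w - f z) / (w - z)
         @[w --> within [set w | 0 <= w /\ w != z] (nbhs z)]) = l.
Proof.
move=> z0 fl.
(* Without properness the limit would not be determined. *)
have FF : ProperFilter (within [set w : R | 0 <= w /\ w != z] (nbhs z)).
  apply: within_nbhs_proper => U /nbhs_ballP[e /= e0 zeU].
  exists (z + e / 2); split => /=; first split.
  - by rewrite addr_ge0// divr_ge0// ltW.
  - by rewrite gt_eqF// ltrDl divr_gt0.
  apply: zeU; rewrite -ball_normE /= distrC ltr_norml; apply/andP; split; lra.
apply/cvg_lim => //; apply/cvgrPdist_le => e e0.
have K0 : 0 <= K.
  have := fl (z + 1) (addr_ge0 z0 ler01) (lexx _).
  by rewrite [z + 1 - z]addrAC subrr add0r expr1n mulr1; apply: le_trans.
have d0 : 0 < Num.min 1 (e / (K + 1)).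
  by rewrite lt_min ltr01 divr_gt0// ltr_wpDl.
have : \forall w \near nbhs z, `|z - w| < Num.min 1 (e / (K + 1)).
  by apply/nbhs_ballP; exists (Num.min 1 (e / (K + 1))).
rewrite near_withinE; apply: filterS => w /=.
rewrite lt_min => /andP[zw1 zwe] [w0 wz].
have wz0 : w - z != 0 by rewrite subr_eq0.
have wz1 : w <= z + 1.
  by move: zw1; rewrite distrC ltr_norml => /andP[_]; lra.
have -> : l - (f w - f z) / (w - z) =
    - (f w - f z - (w - z) * l) / (w - z) by field.
rewrite normrM normrN normfV ler_pdivrMr ?normr_gt0//.
rewrite (le_trans (fl w w0 wz1))// -[(w - z) ^+ 2]real_normK ?num_real//.
rewrite expr2 mulrA ler_wpM2r//.
rewrite distrC; apply: (@le_trans _ _ ((K + 1) * (e / (K + 1)))).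
  by rewrite ler_pM// ?lerDl// ltW.
by rewrite mulrC divfK// gt_eqF// ltr_wpDl.
Qed.

(** * Mass of a measure off its support *)

(** The complement of the support is covered by null open sets; the line being
    second countable, the null intervals with rational end points suffice. *)
Lemma measure_support_negligible (R : realType)
    (nu : {measure set (measurableTypeR R) -> \bar R}) :
  nu.-negligible (~` measure_support nu).
Proof.
pose I (n : nat) : set R :=
  if (@unpickle (rat * rat)%type n) is Some (p, q)
  then if nu `]ratr p, ratr q[%classic == 0%E then `]ratr p, ratr q[%classic
       else set0
  else set0.
apply: (@negligibleS _ (measurableTypeR R) R nu (\bigcup_n I n)); last first.
  apply: negligible_bigcup => n; rewrite /I.
  case: unpickle => [[p q]|]; last exact: negligible_set0.
  case: eqP => [nu0|_]; last exact: negligible_set0.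
  by apply/negligibleP => //; exact: measurable_itv.
move=> y /existsNP[U /not_implyP[[oU Uy] /negP nuU]].
move: nuU; rewrite -leNgt => nuU.
have /nbhs_ballP[e /= e0 yeU] : nbhs y U by apply: open_nbhs_nbhs; split.
have /rat_in_itvoo[p pye] : y - e < y by rewrite ltrBlDr ltrDl.
have /rat_in_itvoo[r yre] : y < y + e by rewrite ltrDl.
move: pye yre; rewrite !in_itv/= => /andP[yep py] /andP[yr rye].
have nu0 : nu `]ratr p, ratr r[%classic = 0%E.
  apply/eqP; rewrite -measure_le0 (le_trans _ nuU)// le_measure ?inE//.
    exact: open_measurable.
  move=> x /=; rewrite in_itv/= => /andP[px xr]; apply: yeU.
  by rewrite -ball_normE /= ltr_norml; apply/andP; split; lra.
exists (pickle (p, r)); first by [].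
rewrite /I pickleK nu0 eqxx.
by rewrite /= in_itv/= py yr.
Qed.

(** * Estimates on the integrand of the Levy exponent *)

Section levy_kernel.
Context {R : realType}.
Implicit Types (z w y c Z : R).

(** The integrand of [levy_exponent]. *)
Definition levy_kernel z y : R :=
  expR (- z * y) - 1 + z * y * \1_(`]-1, 1[ : set R) y.

(** The derivative of [levy_kernel] in z. *)
Definition levy_kernel' z y : R :=
  y * \1_(`]-1, 1[ : set R) y - y * expR (- z * y).

Lemma measurable_levy_kernel z (D : set R) : measurable_fun D (levy_kernel z).
Proof.
have mz k : measurable_fun setT (fun y : R => k * y) by exact: mulrl_measurable.
apply: measurable_funTS; apply: measurable_funD.
  by apply: measurable_funB => //; exact: measurableT_comp.
by apply: measurable_funM => //; exact: measurable_indic.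
Qed.

Lemma measurable_levy_kernel' z (D : set R) : measurable_fun D (levy_kernel' z).
Proof.
have mz k : measurable_fun setT (fun y : R => k * y) by exact: mulrl_measurable.
apply: measurable_funTS; apply: measurable_funB.
  by apply: measurable_funM => //; exact: measurable_indic.
by apply: measurable_funM => //; exact: measurableT_comp.
Qed.

(** The exponent stays bounded because negative jumps are bounded below. *)
Lemma levy_exp_le z y c Z : 0 <= c -> 0 <= z -> z <= Z -> - c <= y ->
  - z * y <= Z * c.
Proof. by move=> *; nra. Qed.

(** For small jumps the linear compensator cancels the first order term, leaving a
    quadratic remainder; for |y| >= 1 boundedness of the exponential is enough,
    as then 1 <= y^2. *)
Lemma levy_kernel_le z y c Z : 0 <= c -> 0 <= z -> z <= Z -> - c <= y ->
  `|levy_kernel z y| <= (Z ^+ 2 + 1) * expR (Z * c) * y ^+ 2.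
Proof.
move=> c0 z0 zZ cy.
have zB := levy_exp_le c0 z0 zZ cy.
have Z0 : 0 <= Z by exact: le_trans zZ.
have B0 : 0 <= Z * c by exact: mulr_ge0.
have M1 : 1 <= expR (Z * c) by rewrite -expR0 ler_expR.
have y2 := sqr_ge0 y.
rewrite /levy_kernel indicE; case: (boolP (y \in _)) => yin.
  have := expR_taylor1 zB B0; rewrite expR0 subr0 mulr1.
  rewrite mulr1 mulNr opprK => /le_trans; apply.
  rewrite sqrrN exprMn mulrA ler_wpM2r// [leRHS]mulrC ler_wpM2l ?expR_ge0//.
  by rewrite ler_wpDr// lerXn2r ?nnegrE.
have y1 : 1 <= y ^+ 2.
  move: yin; rewrite notin_setE/= in_itv/= => /negP.
  by rewrite negb_and -!leNgt => /orP[]; nra.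
rewrite mulr0 addr0; apply: (@le_trans _ _ (expR (Z * c))).
  have : expR (- z * y) <= expR (Z * c) by rewrite ler_expR.
  have := expR_ge0 (- z * y).
  by rewrite ler_norml => h1 h2; apply/andP; split; lra.
rewrite mulrAC ler_peMl ?expR_ge0//.
by rewrite (le_trans y1)// ler_peMl// lerDr sqr_ge0.
Qed.

Lemma levy_kernel'_le z y c Z : 0 <= c -> 0 <= z -> z <= Z -> - c <= y ->
  `|levy_kernel' z y| <= (Z + 1) * expR (Z * c) * y ^+ 2.
Proof.
move=> c0 z0 zZ cy.
have zB := levy_exp_le c0 z0 zZ cy.
have Z0 : 0 <= Z by exact: le_trans zZ.
have B0 : 0 <= Z * c by exact: mulr_ge0.
have y2 := sqr_ge0 y.
rewrite /levy_kernel' indicE; case: (boolP (y \in _)) => yin.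
  have := expR_lipschitz B0 zB; rewrite expR0 -mulrBr normrM => exp_le.
  apply: (@le_trans _ _ (`|y| * (expR (Z * c) * (Z * `|y|)))).
    rewrite ler_wpM2l// (le_trans exp_le)//.
    rewrite ler_wpM2l ?expR_ge0// sub0r mulNr opprK normrM ger0_norm//.
    by rewrite ler_wpM2r.
  rewrite -[y ^+ 2]real_normK ?num_real//.
  have := mulr_ge0 (expR_ge0 (Z * c)) (sqr_ge0 `|y|).
  by move: `|y| (expR (Z * c)) => u M; lra.
have y1 : 1 <= `|y|.
  move: yin; rewrite notin_setE/= in_itv/= => /negP.
  by rewrite -ltr_norml -leNgt.
rewrite mulr0 sub0r normrN normrM [`|expR _|]ger0_norm ?expR_ge0//.
rewrite -[y ^+ 2]real_normK ?num_real//.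
have : expR (- z * y) <= expR (Z * c) by rewrite ler_expR.
have := expR_ge0 (- z * y); have : 0 <= Z * expR (Z * c) * `|y| ^+ 2.
  by rewrite !mulr_ge0 ?expR_ge0.
move: `|y| y1 (expR (- z * y)) (expR (Z * c)) => u u1 v M ZM v0 vM.
have : u * v <= u * M by rewrite ler_wpM2l// (le_trans ler01).
have : 0 <= M * u * (u - 1).
  by rewrite !mulr_ge0 ?subr_ge0 ?(le_trans ler01 u1)// (le_trans v0).
by move: ZM; lra.
Qed.

Lemma levy_kernel_taylor z w y c Z : 0 <= c -> 0 <= z -> z <= Z ->
  0 <= w -> w <= Z -> - c <= y ->
  `|levy_kernel w y - levy_kernel z y - (w - z) * levy_kernel' z y| <=
    expR (Z * c) * (w - z) ^+ 2 * y ^+ 2.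
Proof.
move=> c0 z0 zZ w0 wZ cy.
rewrite -mulrA -exprMn.
have := expR_taylor1 (levy_exp_le c0 w0 wZ cy) (levy_exp_le c0 z0 zZ cy).
rewrite (_ : (- w * y - - z * y) ^+ 2 = ((w - z) * y) ^+ 2); last by ring.
congr (`|_| <= _); rewrite /levy_kernel /levy_kernel'; ring.
Qed.

Lemma levy_kernel'_lipschitz z w y c Z : 0 <= c -> 0 <= z -> z <= Z ->
  0 <= w -> w <= Z -> - c <= y ->
  `|levy_kernel' w y - levy_kernel' z y| <=
    expR (Z * c) * `|w - z| * y ^+ 2.
Proof.
move=> c0 z0 zZ w0 wZ cy.
have -> : levy_kernel' w y - levy_kernel' z y =
    y * (expR (- z * y) - expR (- w * y)) by rewrite /levy_kernel'; ring.
have := expR_lipschitz (levy_exp_le c0 z0 zZ cy) (levy_exp_le c0 w0 wZ cy).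
have -> : - z * y - - w * y = (w - z) * y by ring.
rewrite !normrM -[y ^+ 2]real_normK ?num_real// => /(ler_wpM2l (normr_ge0 y)).
move=> /le_trans; apply.
by rewrite expr2 le_eqVlt; apply/orP; left; apply/eqP; ring.
Qed.

End levy_kernel.

(** * Derivative of the Levy exponent *)

Section levy_exponent_derivative.
Context {R : realType}.
Variables (a q c : R) (nu : {measure set (measurableTypeR R) -> \bar R}).
Hypotheses (c_ge0 : 0 <= c) (nu_left : nu `]-oo, (- c)]%classic = 0%E).
Local Notation D := (`]- c, +oo[%classic : set R).
Hypothesis nu_square_integrable :
  nu.-integrable D (EFin \o (fun y : R => y ^+ 2)).
Local Notation S := (\int[nu]_(y in D) y ^+ 2).

Let mD : measurable (D : set (measurableTypeR R)).
Proof. exact: measurable_itv. Qed.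

Let cD y : D y -> - c <= y.
Proof. by rewrite /= in_itv/= andbT => /ltW. Qed.

Lemma integrable_levy_kernel z : 0 <= z ->
  nu.-integrable D (EFin \o levy_kernel z).
Proof.
move=> z0.
apply: (proj1 (Rintegral_dominated mD _ nu_square_integrable _)) => [|y /cD cy].
  exact: measurable_levy_kernel.
exact: levy_kernel_le c_ge0 z0 (lexx z) cy.
Qed.

Lemma integrable_levy_kernel' z : 0 <= z ->
  nu.-integrable D (EFin \o levy_kernel' z).
Proof.
move=> z0.
apply: (proj1 (Rintegral_dominated mD _ nu_square_integrable _)) => [|y /cD cy].
  exact: measurable_levy_kernel'.
exact: levy_kernel'_le c_ge0 z0 (lexx z) cy.
Qed.

(** The mass vanishing left of -c, the integral over the line reduces to D,
    where the integrand is dominated. *)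
Lemma levy_exponentE z : 0 <= z ->
  fine (levy_exponent a q nu z) =
  - a * z + q / 2 * z ^+ 2 + \int[nu]_(y in D) levy_kernel z y.
Proof.
move=> z0; pose N : set (measurableTypeR R) := `]-oo, (- c)]%classic.
have mN : measurable N by exact: measurable_itv.
have NE : setT `\` N = D by rewrite setTD /N setCitvl.
have ik := integrable_levy_kernel z0.
have ikT : nu.-integrable setT (EFin \o levy_kernel z).
  apply: (negligible_integrable mN measurableT _ nu_left).2; rewrite ?NE//.
  by apply/measurable_EFinP; exact: measurable_levy_kernel.
rewrite /levy_exponent.
have -> : (\int[nu]_y (expR (- z * y) - 1 + z * y * \1_(`]-1, 1[ : set R) y)%:E
    = \int[nu]_(y in D) (levy_kernel z y)%:E)%E.
  by rewrite -NE -negligible_integral.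
by rewrite fineD// integrable_fin_num.
Qed.

(** Differentiation under the integral sign: the Taylor remainder of the integrand
    is quadratic in w - z with an integrable coefficient. *)
Lemma levy_exponent'E z : 0 <= z ->
  levy_exponent' a q nu z =
  - a + q * z + \int[nu]_(y in D) levy_kernel' z y.
Proof.
move=> z0.
(* Since the slope is a local notion, w may be restricted to [0, z + 1], where the
   estimates are uniform. *)
apply: (@lim_slope _ _ _ _ (`|q / 2| + expR ((z + 1) * c) * S) z0) => w w0 wz.
rewrite !levy_exponentE//.
have zz : z <= z + 1 by rewrite lerDl.
have iw := integrable_levy_kernel w0.
have iz := integrable_levy_kernel z0.
have iz' := integrable_levy_kernel' z0.
have izl : nu.-integrable D (EFin \o (fun y => (w - z) * levy_kernel' z y)).
  exact: integrable_scale.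
have iwz : nu.-integrable D (EFin \o (fun y => levy_kernel w y - levy_kernel z y)).
  exact: (integrableB mD iw iz).
pose f y := levy_kernel w y - levy_kernel z y - (w - z) * levy_kernel' z y.
have : `|\int[nu]_(y in D) f y| <= expR ((z + 1) * c) * (w - z) ^+ 2 * S.
  apply: (proj2 (Rintegral_dominated mD _ nu_square_integrable _)) => [|y /cD cy].
    by have /integrableP[/measurable_EFinP] := integrableB mD iwz izl.
  exact: levy_kernel_taylor.
rewrite /f RintegralB// RintegralB// RintegralZl//.
set A := Rintegral _ _ _; set B := Rintegral _ _ _; set C := Rintegral _ _ _.
move=> ABC; rewrite (_ : _ - _ - _ =
    q / 2 * (w - z) ^+ 2 + (A - B - (w - z) * C)); last by field.
rewrite (le_trans (ler_normD _ _))// [leRHS]mulrDl lerD//.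
  by rewrite normrM [`|_ ^+ 2|]ger0_norm ?sqr_ge0.
by rewrite mulrAC.
Qed.

Lemma levy_exponent'_lipschitz Z z w : 0 <= z -> z <= Z -> 0 <= w -> w <= Z ->
  `|levy_exponent' a q nu w - levy_exponent' a q nu z| <=
    (`|q| + expR (Z * c) * S) * `|w - z|.
Proof.
move=> z0 zZ w0 wZ; rewrite !levy_exponent'E//.
have iw := integrable_levy_kernel' w0.
have iz := integrable_levy_kernel' z0.
pose f y := levy_kernel' w y - levy_kernel' z y.
have : `|\int[nu]_(y in D) f y| <= expR (Z * c) * `|w - z| * S.
  apply: (proj2 (Rintegral_dominated mD _ nu_square_integrable _)) => [|y /cD cy].
    by have /integrableP[/measurable_EFinP] := integrableB mD iw iz.
  exact: levy_kernel'_lipschitz.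
rewrite /f RintegralB//.
set A := Rintegral _ _ _; set B := Rintegral _ _ _ => AB.
rewrite (_ : _ - _ = q * (w - z) + (A - B)); last by ring.
by rewrite (le_trans (ler_normD _ _))// [leRHS]mulrDl lerD ?normrM// mulrAC.
Qed.

End levy_exponent_derivative.

Lemma integrable_square_right (R : realType) (c : R)
    (nu : {measure set (measurableTypeR R) -> \bar R}) : 0 <= c ->
  (\int[nu]_(y in `](- c)%R, 1%R[) (y ^+ 2)%:E < +oo)%E ->
  (\int[nu]_(y in `[0%R, +oo[) (y ^+ 2)%:E < +oo)%E ->
  nu.-integrable (`]- c, +oo[%classic : set R) (EFin \o (fun y : R => y ^+ 2)).
Proof.
move=> c0 left_fin right_fin.
have m2 (A : set R) : measurable_fun A (EFin \o (fun y : R => y ^+ 2)).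
  by apply/measurable_EFinP; exact: exprn_measurable.
have m1 : measurable (`](- c), 1[%classic : set (measurableTypeR R)).
  exact: measurable_itv.
have m3 : measurable (`[1, +oo[%classic : set (measurableTypeR R)).
  exact: measurable_itv.
have m4 : measurable (`[0, +oo[%classic : set (measurableTypeR R)).
  exact: measurable_itv.
have pos (y : R) : (0 <= (y ^+ 2)%:E)%E by rewrite lee_fin sqr_ge0.
apply/integrableP; split; first exact: m2.
suff : (\int[nu]_(y in `](- c)%R, +oo[) (y ^+ 2)%:E < +oo)%E.
  congr (_ < _)%E; apply: eq_integral => y _.
  by rewrite [RHS]gee0_abs// lee_fin sqr_ge0.
have -> : `]- c, +oo[%classic = `](- c), 1[%classic `|` `[1, +oo[%classic :> set R.
  by rewrite -itv_bndbnd_setU ?bnd_simp// (le_lt_trans _ (@ltr01 R))// oppr_le0.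
rewrite ge0_integral_setU//=; last first.
- apply/disj_setPS => y [] /=; rewrite !in_itv/= andbT => /andP[_ y1].
  by rewrite leNgt y1.
- exact: m2.
apply: lte_add_pinfty => //; apply: le_lt_trans right_fin.
apply: ge0_subset_integral => //; first exact: m2.
move=> y /=; rewrite !in_itv/= !andbT.
exact: le_trans.
Qed.

Lemma levy_measure_left0 (R : realType) (c : R)
    (nu : {measure set (measurableTypeR R) -> \bar R}) :
  measure_support nu `<=` `](- c), +oo[ -> nu `]-oo, (- c)]%classic = 0%E.
Proof.
move=> supp; apply: measure_negligible; first exact: measurable_itv.
apply: negligibleS (measure_support_negligible nu) => y.
rewrite /= in_itv/= => yc /supp; rewrite /= in_itv/= andbT.
by rewrite ltNge yc.
Qed.

(** * Uniqueness for a deterministic path *)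

Lemma Rintegral_expR_le (R : realType) (b t : R) : 0 < b -> 0 <= t ->
  (@lebesgue_measure R).-integrable `[0, t] (EFin \o (fun s => expR (b * s))) /\
  \int[lebesgue_measure]_(s in `[0, t]) expR (b * s) <= expR (b * t) / b.
Proof.
move=> b0 t0.
have cexp : continuous (fun s : R => expR (b * s)).
  move=> s; apply: continuous_comp; last exact: continuous_expR.
  exact: mulrl_continuous.
split.
  apply: continuous_compact_integrable; first exact: segment_compact.
  exact: continuous_subspaceT.
have [t1|] := ltP 0 t; last first.
  move=> t0'; have -> : t = 0 by apply/le_anti/andP.
  by rewrite set_itv1 Rintegral_set1 divr_ge0 ?expR_ge0// ltW.
rewrite /Rintegral.
rewrite (@continuous_FTC2 _ _ (fun s => b^-1 * expR (b * s))) //.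
- by rewrite /= mulr0 expR0 mulr1 mulrC gerBl invr_ge0 ltW.
- exact: continuous_subspaceT.
- have cF : continuous (fun s : R => b^-1 * expR (b * s)).
    by move=> s; apply: cvgMr; exact: cexp.
  split.
  + by move=> z _; exact: ex_derive.
  + by apply/cvg_at_right_filter; exact: cF.
  + by apply/cvg_at_left_filter; exact: cF.
- move=> s _; rewrite derive1E derive_val.
  rewrite /GRing.scale/=; field; exact: lt0r_neq0.
Qed.

Section uniqueness.
Context {R : realType}.
Local Notation mu := (@lebesgue_measure R).
Local Notation Rplus := (`[0, +oo[%classic : set R).
Variables (T Lam K C : R) (J' : R -> R) (lam atil r1 r2 : R -> R -> R).
Hypotheses (Lam_ge0 : 0 <= Lam) (K_ge0 : 0 <= K).
Hypothesis lam_itv : forall s v, 0 <= s <= T -> 0 <= v -> 0 <= lam s v <= Lam.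
Hypothesis J'_lipschitz : forall z w, 0 <= z <= Lam * C -> 0 <= w <= Lam * C ->
  `|J' w - J' z| <= K * `|w - z|.

Definition bounded_mass (r : R -> R -> R) := forall t, 0 <= t <= T ->
  [/\ forall x, 0 <= x -> 0 <= r t x,
      mu.-integrable Rplus (EFin \o r t) &
      \int[mu]_(x in Rplus) r t x <= C].

Hypotheses (r1_mass : bounded_mass r1) (r2_mass : bounded_mass r2).

(** The argument of J' in the equation. *)
Definition cumulative (r : R -> R -> R) s y : R :=
  \int[mu]_(v in `[0, y]) (lam s v * r s v).

(** The exponent in the equation. *)
Definition drift (r : R -> R -> R) t x : R :=
  \int[mu]_(s in `[0, t]) (J' (cumulative r s (t - s + x)) * lam s (t - s + x)).

Definition L1dist t : R := \int[mu]_(x in Rplus) `|r1 t x - r2 t x|.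

Let subRplus y : `[0, y]%classic `<=` Rplus.
Proof. by move=> x /=; rewrite !in_itv/= andbT => /andP[]. Qed.

Let integrable_sub y f : mu.-integrable Rplus f -> mu.-integrable `[0, y] f.
Proof. by apply: integrableS => //; exact: subRplus. Qed.

Lemma integrable_dist t : 0 <= t <= T ->
  mu.-integrable Rplus (EFin \o (fun x => `|r1 t x - r2 t x|)).
Proof.
move=> tT; have [_ i1 _] := r1_mass tT; have [_ i2 _] := r2_mass tT.
by apply: integrable_norm; exact: (integrableB _ i1 i2).
Qed.

Lemma cumulative_itv r s y : bounded_mass r -> 0 <= s <= T ->
  mu.-integrable `[0, y] (EFin \o (fun v => lam s v * r s v)) ->
  0 <= cumulative r s y <= Lam * C.
Proof.
move=> rm sT ilr; have [r0 ir rC] := rm _ sT.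
have itv0 v : `[0, y]%classic v -> 0 <= v by rewrite /= in_itv/= => /andP[].
apply/andP; split.
  apply: Rintegral_ge0 => v /itv0 v0.
  by rewrite mulr_ge0 ?r0//; have /andP[] := lam_itv sT v0.
apply: (@le_trans _ _ (Lam * \int[mu]_(x in Rplus) r s x)); last first.
  by rewrite ler_wpM2l.
apply: (@le_trans _ _ (Lam * \int[mu]_(x in `[0, y]) r s x)).
  rewrite -RintegralZl//; last exact: integrable_sub.
  apply: le_Rintegral => //.
    by apply: integrable_scale => //; exact: integrable_sub.
  move=> v /itv0 v0; rewrite ler_wpM2r ?r0//.
  by have /andP[] := lam_itv sT v0.
rewrite ler_wpM2l// /Rintegral fine_le//.
- by apply: integrable_fin_num => //; exact: integrable_sub.
- exact: integrable_fin_num.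
apply: ge0_subset_integral => //; first by case/integrableP: ir.
by move=> x /=; rewrite in_itv/= andbT lee_fin; exact: r0.
Qed.

Lemma cumulative_dist s y : 0 <= s <= T ->
  mu.-integrable `[0, y] (EFin \o (fun v => lam s v * r1 s v)) ->
  mu.-integrable `[0, y] (EFin \o (fun v => lam s v * r2 s v)) ->
  `|cumulative r1 s y - cumulative r2 s y| <= Lam * L1dist s.
Proof.
move=> sT i1 i2; have idist := integrable_dist sT.
have idy : mu.-integrable `[0, y] (EFin \o (fun x => `|r1 s x - r2 s x|)).
  exact: integrable_sub.
have itv0 v : `[0, y]%classic v -> 0 <= v by rewrite /= in_itv/= => /andP[].
rewrite /cumulative -RintegralB//.
pose f v := lam s v * r1 s v - lam s v * r2 s v.
have : `|\int[mu]_(v in `[0, y]) f v| <=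
    Lam * \int[mu]_(x in `[0, y]) `|r1 s x - r2 s x|.
  apply: (proj2 (Rintegral_dominated _ _ idy _)) => // [|v /itv0 v0].
    by apply: measurable_funB;
      [exact: measurable_integrand i1|exact: measurable_integrand i2].
  rewrite /f -mulrBr normrM ler_wpM2r//.
  by have /andP[l0 lL] := lam_itv sT v0; rewrite ger0_norm.
move=> /le_trans; apply; rewrite ler_wpM2l// /L1dist /Rintegral fine_le//.
- exact: integrable_fin_num.
- exact: integrable_fin_num.
apply: ge0_subset_integral => //.
by case/integrableP: idist.
Qed.

Hypothesis eq1 : forall t x, 0 <= t <= T -> 0 <= x ->
  satisfies_equation J' lam atil r1 t x.
Hypothesis eq2 : forall t x, 0 <= t <= T -> 0 <= x ->
  satisfies_equation J' lam atil r2 t x.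

(** The bound is uniform in x, since [cumulative_dist] controls the inner integrals
    by the full L^1 distance.  It is stated through an integrable majorant g
    because L1dist itself may fail to be measurable in time. *)
Lemma drift_dist t x g : 0 <= t <= T -> 0 <= x ->
  mu.-integrable `[0, t] (EFin \o g) ->
  (forall s, 0 <= s <= t -> L1dist s <= g s) ->
  `|drift r1 t x - drift r2 t x| <=
    K * Lam ^+ 2 * \int[mu]_(s in `[0, t]) g s.
Proof.
move=> /andP[t0 tT] x0 ig dg.
have [ic1 id1 _] := eq1 (introT andP (conj t0 tT)) x0.
have [ic2 id2 _] := eq2 (introT andP (conj t0 tT)) x0.
rewrite /drift -RintegralB//.
apply: (proj2 (Rintegral_dominated _ _ ig _)) => // [|s].
  by apply: measurable_funB;
    [exact: measurable_integrand id1|exact: measurable_integrand id2].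
rewrite /= in_itv/= => st.
have sT : 0 <= s <= T by have /andP[-> /le_trans] := st; apply.
have y0 : 0 <= t - s + x by rewrite addr_ge0// subr_ge0; have /andP[] := st.
have /andP[l0 lL] := lam_itv sT y0.
have i1 := ic1 _ st; have i2 := ic2 _ st.
have c1 := cumulative_itv r1_mass sT i1.
have c2 := cumulative_itv r2_mass sT i2.
rewrite -mulrBl normrM [`|lam _ _|]ger0_norm//.
rewrite (_ : K * Lam ^+ 2 * g s = K * (Lam * g s) * Lam); last by ring.
rewrite ler_pM// (le_trans (J'_lipschitz c2 c1))// ler_wpM2l//.
by rewrite (le_trans (cumulative_dist sT i1 i2))// ler_wpM2l// dg.
Qed.

(** The common factor atil is absorbed back into r1 and r2, whose masses are at
    most C. *)
Lemma L1dist_le t e : 0 <= t <= T ->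
  (forall x, 0 <= x -> `|drift r1 t x - drift r2 t x| <= e) ->
  L1dist t <= 2 * C * e.
Proof.
move=> tT de; have [r10 i1 C1] := r1_mass tT; have [r20 i2 C2] := r2_mass tT.
have e0 : 0 <= e by exact: le_trans (normr_ge0 _) (de 0 (lexx _)).
have i12 : mu.-integrable Rplus (EFin \o (fun x => r1 t x + r2 t x)).
  exact: (integrableD _ i1 i2).
apply: (@le_trans _ _ (e * \int[mu]_(x in Rplus) (r1 t x + r2 t x))).
  rewrite /L1dist -RintegralZl//; apply: le_Rintegral => //.
  - exact: integrable_dist.
  - exact: integrable_scale.
  move=> x; rewrite /= in_itv/= andbT => x0.
  have [_ _ E1] := eq1 tT x0; have [_ _ E2] := eq2 tT x0.
  have absE u e' : u = atil t x * expR e' -> 0 <= u -> u = `|atil t x| * expR e'.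
    by move=> ue u0; rewrite -(ger0_norm u0) ue normrM (ger0_norm (expR_ge0 _)).
  have ar1 := absE _ (drift r1 t x) E1 (r10 _ x0).
  have ar2 := absE _ (drift r2 t x) E2 (r20 _ x0).
  have -> : `|r1 t x - r2 t x| =
      `|atil t x| * `|expR (drift r1 t x) - expR (drift r2 t x)|.
    by rewrite {1}ar1 {1}ar2 -mulrBr normrM normr_id.
  pose m := Num.max (drift r1 t x) (drift r2 t x).
  have m1 : drift r1 t x <= m by rewrite /m le_max lexx.
  have m2 : drift r2 t x <= m by rewrite /m le_max lexx orbT.
  apply: (@le_trans _ _ (`|atil t x| * (expR m * e))).
    rewrite ler_wpM2l// (le_trans (expR_lipschitz m1 m2))// ler_wpM2l ?expR_ge0//.
    exact: de.
  rewrite mulrA mulrC ler_wpM2l//.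
  rewrite ar1 ar2 -mulrDr ler_wpM2l// /m.
  have [d|/ltW d] := leP (drift r1 t x) (drift r2 t x).
    by rewrite lerDr expR_ge0.
  by rewrite lerDl expR_ge0.
rewrite mulrC ler_wpM2r// RintegralD//.
by rewrite mulr_natl mulr2n lerD.
Qed.

(** Gronwall by contraction: in the norm weighted by exp(- b t), the map bounding
    L1dist by a multiple of its time integral has factor A / b <= 1 / 2. *)
Lemma L1dist_le0 t : 0 <= t <= T -> L1dist t <= 0.
Proof.
move=> tT; have /andP[t0 _] := tT.
have T0 : 0 <= T by have /andP[/le_trans] := tT; apply.
have C0 : 0 <= C.
  have [r0 _ ] := r1_mass tT; apply: le_trans; apply: Rintegral_ge0 => x.
  by rewrite /= in_itv/= andbT; exact: r0.
pose A := 2 * C * (K * Lam ^+ 2).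
have A0 : 0 <= A by rewrite !mulr_ge0// sqr_ge0.
pose b := 2 * A + 1.
have b0 : 0 < b by rewrite ltr_wpDl// mulr_ge0.
pose wdist s := L1dist s * expR (- (b * s)).
pose M := sup (wdist @` `[0, T]).
have L1dist_le2C s : 0 <= s <= T -> L1dist s <= 2 * C.
  move=> sT; have [r10 i1 C1] := r1_mass sT; have [r20 i2 C2] := r2_mass sT.
  apply: (@le_trans _ _ (\int[mu]_(x in Rplus) (r1 s x + r2 s x))).
    apply: le_Rintegral => //; first exact: integrable_dist.
      exact: (integrableD _ i1 i2).
    move=> x; rewrite /= in_itv/= andbT => x0.
    by have := r10 _ x0; have := r20 _ x0; rewrite ler_norml; lra.
  by rewrite RintegralD// mulr_natl mulr2n lerD.
have hs : has_sup (wdist @` `[0, T]).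
  split; first by exists (wdist 0), 0; rewrite //= in_itv/= lexx.
  exists (2 * C) => _ [s sT <-]; move: sT; rewrite /= in_itv/= => sT.
  rewrite -[leRHS]mulr1 ler_pM ?expR_ge0 ?L1dist_le2C//.
    exact: Rintegral_ge0.
  by rewrite expR_le1 oppr_le0 mulr_ge0 ?(ltW b0)//; have /andP[] := sT.
have distM s : 0 <= s <= T -> L1dist s <= M * expR (b * s).
  move=> sT; rewrite -ler_pdivrMr ?expR_gt0// -expRN.
  by apply: (sup_upper_bound hs); exists s; rewrite //= in_itv.
have M0 : 0 <= M.
  have := distM 0 (introT andP (conj (lexx 0) T0)).
  by rewrite mulr0 expR0 mulr1; apply: le_trans; exact: Rintegral_ge0.
have distM2 s : 0 <= s <= T -> wdist s <= M / 2.
  move=> sT; have /andP[s0 sT'] := sT.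
  have [iexp exp_le] := Rintegral_expR_le b0 s0.
  have dle : L1dist s <= 2 * C * (K * Lam ^+ 2 * (M * (expR (b * s) / b))).
    apply: L1dist_le => // x x0.
    apply: (le_trans (drift_dist (g := fun u => M * expR (b * u)) sT x0 _ _)).
    - exact: integrable_scale.
    - move=> u /andP[u0 us]; apply: distM.
      by rewrite u0 (le_trans us).
    rewrite RintegralZl// ler_wpM2l ?mulr_ge0 ?sqr_ge0//.
    by rewrite ler_wpM2l.
  rewrite /wdist expRN ler_pdivrMr ?expR_gt0// (le_trans dle)//.
  rewrite (_ : 2 * C * _ = M * expR (b * s) * (A / b)); last by rewrite /A; ring.
  rewrite [leRHS]mulrAC ler_wpM2l ?mulr_ge0 ?expR_ge0//.
  by rewrite ler_pdivrMr// /b; lra.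
have MM : M <= M / 2.
  apply: ge_sup; first by have [] := hs.
  by move=> _ [s sT <-]; apply: distM2; move: sT; rewrite /= in_itv.
have {}M0 : M = 0 by apply/le_anti; rewrite M0 andbT; lra.
by have := distM t tT; rewrite M0 mul0r.
Qed.

(** The distance vanishes in L^1 only, but the drifts depend on r1 and r2
    through integrals, so they agree at every point, and then so do r1 and r2. *)
Lemma equation_unique t x : 0 <= t <= T -> 0 <= x -> r1 t x = r2 t x.
Proof.
move=> tT x0; have [_ _ ->] := eq1 tT x0; have [_ _ ->] := eq2 tT x0.
congr (_ * expR _); rewrite -/(drift r1 t x) -/(drift r2 t x).
apply/eqP; rewrite -subr_eq0 -normr_le0.
have i0 : mu.-integrable `[0, t] (EFin \o (fun=> 0 : R)) by exact: integrable0.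
have := drift_dist tT x0 i0; rewrite Rintegral_cst// mul0r mulr0; apply.
move=> s /andP[s0 st]; apply: L1dist_le0; rewrite s0 (le_trans st)//.
by have /andP[] := tT.
Qed.

End uniqueness.

(** * Mass of non-exploding paths *)

Section L2gamma_mass.
Context {R : realType}.
Local Notation mu := (@lebesgue_measure R).
Local Notation Rplus := (`[0, +oo[%classic : set R).

Lemma integrable_expRN (gamma : R) : 0 < gamma ->
  mu.-integrable Rplus (EFin \o (fun x => expR (- (gamma * x)))).
Proof.
move=> gamma0.
have ipdf : mu.-integrable Rplus (EFin \o exponential_pdf gamma).
  by apply: integrableS (integrable_exponential_pdf gamma0).
apply: eq_integrable (integrable_scale gamma^-1 _ ipdf) => //.
move=> x; rewrite inE/= in_itv/= andbT => x0.
rewrite exponential_pdfE//= mulrA mulVf ?gt_eqF// mul1r.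
by rewrite mulNr.
Qed.

(** Pointwise, h <= h^2 p + 1 / p for every p > 0; take p = exp(gamma x). *)
Lemma L2gamma_mass (gamma N : R) (h : R -> R) : 0 < gamma ->
  L2gamma gamma h -> (normsq_gamma gamma h <= N%:E)%E ->
  mu.-integrable Rplus (EFin \o h) /\
  \int[mu]_(x in Rplus) h x <=
    N + \int[mu]_(x in Rplus) expR (- (gamma * x)).
Proof.
move=> gamma0 [mh h0 hfin] hN.
pose hsq x := `|h x| ^+ 2 * expR (gamma * x).
have hsq0 x : 0 <= hsq x by rewrite mulr_ge0 ?expR_ge0.
have ihsq : mu.-integrable Rplus (EFin \o hsq).
  apply/integrableP; split.
    apply/measurable_EFinP; apply: measurable_funM.
      by apply: measurable_funX; exact: measurableT_comp.
    have mg : measurable_fun setT (fun x : R => gamma * x).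
      exact: mulrl_measurable.
    by apply: measurable_funTS; exact: measurableT_comp.
  move: hfin; congr (_ < _)%E; apply: eq_integral => x _.
  by rewrite [RHS]gee0_abs// lee_fin hsq0.
have iexp := integrable_expRN gamma0.
have isum : mu.-integrable Rplus (EFin \o (fun x => hsq x + expR (- (gamma * x)))).
  exact: (integrableD _ ihsq iexp).
have [ih] : mu.-integrable Rplus (EFin \o h) /\ `|\int[mu]_(x in Rplus) h x| <=
    1 * \int[mu]_(x in Rplus) (hsq x + expR (- (gamma * x))).
  apply: Rintegral_dominated => // x; rewrite /= in_itv/= andbT => /h0 hx0.
  rewrite mul1r /hsq expRN ger0_norm//.
  have := expR_gt0 (gamma * x); move: (expR _) => p p0.
  have pV : p * p^-1 = 1 by rewrite divff// gt_eqF.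
  have : 0 < p^-1 by rewrite invr_gt0.
  move: (p^-1) pV => v pv v0.
  have : 0 <= p * (h x - v) ^+ 2 by rewrite mulr_ge0 ?sqr_ge0// ltW.
  have -> : p * (h x - v) ^+ 2 = p * h x ^+ 2 - (p * v) * (2 * h x - v) by ring.
  by rewrite pv; lra.
rewrite mul1r RintegralD// => /(le_trans (ler_norm _)) hle.
split=> //; apply: (le_trans hle); rewrite lerD2r.
by rewrite -lee_fin fineK//; exact: integrable_fin_num.
Qed.

Lemma LL2gamma_bounded_mass (T gamma : R) (r : R -> R -> R) :
  0 <= T -> 0 < gamma -> LL2gamma T gamma r -> exists C, bounded_mass T C r.
Proof.
move=> T0 gamma0 [rL2 sup_fin].
set V := [set normsq_gamma gamma (r t) | t in `[0, T]%classic] in sup_fin.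
have supV t : 0 <= t <= T -> (normsq_gamma gamma (r t) <= ereal_sup V)%E.
  by move=> tT; apply: ereal_sup_ubound; exists t; rewrite //= in_itv.
have sup0 : (0 <= ereal_sup V)%E.
  apply: le_trans (supV 0 _); last by rewrite lexx.
  by apply: integral_ge0 => x _; rewrite lee_fin mulr_ge0 ?expR_ge0.
exists (fine (ereal_sup V) + \int[mu]_(x in Rplus) expR (- (gamma * x))) => t tT.
have : (normsq_gamma gamma (r t) <= (fine (ereal_sup V))%:E)%E.
  by rewrite fineK ?ge0_fin_numE// supV.
by move=> /(L2gamma_mass gamma0 (rL2 t tT)) [ir rle]; have [] := rL2 t tT.
Qed.

End L2gamma_mass.

(** The infimum of a set without lower bound is 0 by convention, so a positive
    infimum is a genuine lower bound. *)
Lemma vol_itv (R : realType) (T : R) (lam : R -> R -> R) (s v : R) :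
  0 < vol_inf T lam -> has_ubound (vol_range T lam) ->
  0 <= s <= T -> 0 <= v -> 0 < lam s v <= vol_sup T lam.
Proof.
move=> inf_gt0 ub sT v0.
have lamsv : vol_range T lam (lam s v) by exists s, v.
have hi : has_inf (vol_range T lam).
  apply: contrapT => /inf_out infE.
  by move: inf_gt0; rewrite /vol_inf infE ltxx.
rewrite (lt_le_trans inf_gt0) ?ub_le_sup//.
by apply: ge_inf => //; have [] := hi.
Qed.

(** * The theorem *)

Theorem theorem3p6 (R : realType) (d : measure_display)
    (Omega : measurableType d) (P : probability Omega R)
    (F : R -> set (set Omega)) (Tstar gamma : R)
    (L : R -> Omega -> R) (a q : R)
    (nu : {measure set (measurableTypeR R) -> \bar R})
    (lam : R -> R -> R) (r0 : R -> R) (I : R -> R -> Omega -> R)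
    (Tstar_gt0 : 0 < Tstar) (gamma_gt0 : 0 < gamma)
    (F_filtration : filtration F)
    (L_levy : levy_process P F L)
    (q_ge0 : 0 <= q) (nu_levy : levy_measure nu)
    (L_exponent : has_levy_exponent P L a q nu)
    (lam_continuous : forall x : R, 0 <= x ->
      {within `[0, +oo[, continuous (fun t => lam t x)})
    (lam_lower : 0 < vol_inf Tstar lam)
    (lam_upper : has_ubound (vol_range Tstar lam))
    (I_integral : forall t x : R, 0 <= t <= Tstar -> 0 <= x ->
      is_levy_integral P L (fun s => lam s (t - s + x)) t (I t x))
    (A1 : forall x : R, 0 <= x -> 0 < r0 x)
    (A2 : measure_support nu
            `<=` `](- (vol_sup Tstar lam)^-1), +oo[)
    (A3 : {ae P, forall w, exists M : R, forall t x : R,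
      0 <= t <= Tstar -> 0 <= x -> `|I t x w| <= M})
    (A4 : (\int[nu]_(y in `](- (vol_sup Tstar lam)^-1)%R, 1%R[)
             (y ^+ 2)%:E
           + \int[nu]_(y in `[1%R, +oo[) y%:E < +oo)%E)
    (r0_bounded : has_ubound (r0 @` `[0, +oo[))
    (nu_square : (\int[nu]_(y in `[0%R, +oo[) (y ^+ 2)%:E < +oo)%E)
    (r1 r2 : R -> R -> Omega -> R)
    (r1_solution : is_solution P F Tstar (levy_exponent' a q nu) lam
                     (a_tilde q r0 lam L I) r1)
    (r2_solution : is_solution P F Tstar (levy_exponent' a q nu) lam
                     (a_tilde q r0 lam L I) r2)
    (r1_non_exploding : non_exploding P Tstar gamma r1)
    (r2_non_exploding : non_exploding P Tstar gamma r2) :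
  {ae P, forall w, forall t x : R, 0 <= t <= Tstar -> 0 <= x ->
     r1 t x w = r2 t x w}.
Proof.
have T0 := ltW Tstar_gt0.
set Lam := vol_sup Tstar lam in A2 A4 *.
have lam_itv s v : 0 <= s <= Tstar -> 0 <= v -> 0 < lam s v <= Lam.
  exact: vol_itv.
have Lam_gt0 : 0 < Lam.
  have /andP[l0] : 0 < lam 0 0 <= Lam by apply: lam_itv; rewrite ?lexx.
  exact: lt_le_trans.
have c0 : 0 <= Lam^-1 by rewrite invr_ge0 ltW.
have nu_left := levy_measure_left0 A2.
have nu_square_int := integrable_square_right c0 _ nu_square.
have {}nu_square_int : nu.-integrable (`](- Lam^-1), +oo[%classic : set R)
    (EFin \o (fun y : R => y ^+ 2)).
  apply: nu_square_int; apply: le_lt_trans A4; rewrite leeDl//.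
  apply: integral_ge0 => y /=; rewrite in_itv/= andbT lee_fin.
  exact: le_trans.
apply: filterS2 (filterI (sol_equation r1_solution) r1_non_exploding)
  (filterI (sol_equation r2_solution) r2_non_exploding).
move=> w [eq1 /(LL2gamma_bounded_mass T0 gamma_gt0)[C1 mass1]]
         [eq2 /(LL2gamma_bounded_mass T0 gamma_gt0)[C2 mass2]] t x tT x0.
pose C := Num.max C1 C2.
pose Z := Lam * C.
pose K := `|q| + expR (Z * Lam^-1) *
  \int[nu]_(y in (`](- Lam^-1), +oo[%classic : set R)) y ^+ 2.
have K0 : 0 <= K.
  rewrite addr_ge0// mulr_ge0 ?expR_ge0//.
  by apply: Rintegral_ge0 => y _; exact: sqr_ge0.
have lam_itv' s v : 0 <= s <= Tstar -> 0 <= v -> 0 <= lam s v <= Lam.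
  by move=> sT v0; have /andP[/ltW -> ->] := lam_itv s v sT v0.
have J'_lip z z' : 0 <= z <= Lam * C -> 0 <= z' <= Lam * C ->
    `|levy_exponent' a q nu z' - levy_exponent' a q nu z| <= K * `|z' - z|.
  move=> /andP[z0 zZ] /andP[z'0 z'Z].
  exact: levy_exponent'_lipschitz.
have {}mass1 : bounded_mass Tstar C (fun t x => r1 t x w).
  by move=> s sT; have [h0 ih hC] := mass1 s sT; split; rewrite // le_max hC.
have {}mass2 : bounded_mass Tstar C (fun t x => r2 t x w).
  by move=> s sT; have [h0 ih hC] := mass2 s sT; split; rewrite // le_max hC orbT.
exact: (equation_unique (ltW Lam_gt0) K0 lam_itv' J'_lip mass1 mass2 eq1 eq2).
Qed.
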